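(* Let $E$ be a real (Hausdorff) locally convex space with topological dual $E'$. The assignment $$C \longmapsto s_C|_{B(-C)^0}$$ defines a bijection from the set of all non-empty semi-equicontinuous weak-$*$-closed convex subsets $C \subseteq E'$ onto the set of all continuous positively homogeneous convex functions $f : \Omega \to \mathbb{R}$ defined on non-empty open convex cones $\Omega \subseteq E$.
   Context: $E'$ is the space of continuous linear functionals on $E$, endowed with the weak-$*$-topology (the coarsest topology making all evaluations $\alpha \mapsto \alpha(v)$, $v\in E$, continuous). For $C \subseteq E'$, the support functional is $s_C(v) := \sup_{\alpha \in C} \alpha(v)$, $v \in E$, and $B(C) := \{ v \in E : \inf_{\alpha\in C} \alpha(v) > -\infty\}$; thus $B(-C) = \{v \in E : s_C(v) < \infty\}$, and $B(-C)^0$ denotes its interior. $C$ is called semi-equicontinuous if $s_C$ is bounded on some non-empty open subset of $E$. A convex cone is a convex subset stable under multiplication by positive reals; a function $f$ on such a cone is positively homogeneous if $f(tx)=t f(x)$ for $t>0$. Functions are considered together with their domain $\Omega$, so the claim includes that $B(-C)^0$ is a non-empty open convex cone on which $s_C$ is continuous. *)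

(* Defs.v *)
From HB Require Import structures.
From mathcomp Require Import all_boot all_order all_algebra.
From mathcomp Require Import all_classical all_reals all_analysis.

Set Implicit Arguments.
Unset Strict Implicit.
Unset Printing Implicit Defensive.

Import Order.TTheory GRing.Theory Num.Theory.
Import numFieldNormedType.Exports.

Local Open Scope classical_set_scope.
Local Open Scope ring_scope.

Definition continuous_linear (R : realType) (E : tvsType R) :
    {pred E -> R^o} :=
  mem [set f : E -> R^o | linear f /\ continuous f].

Record dual (R : realType) (E : tvsType R) := Dual {
  dual_val :> E -> R^o ;
  dual_valP : dual_val \in @continuous_linear R E }.

Section dual_structures.
Context (R : realType) (E : tvsType R).

HB.instance Definition _ := [isSub for @dual_val R E].
HB.instance Definition _ := [Choice of dual E by <:].

Lemma continuous_linear_submod : subsemimod_closed (@continuous_linear R E).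
Proof.
split; first split.
- rewrite inE; split; first by move=> a u v; rewrite scaler0 addr0.
  exact: cst_continuous.
- move=> f g; rewrite !inE => -[lf cf] [lg cg]; split.
    by move=> a u v; rewrite /= !fctE lf lg scalerDr addrACA.
  by move=> x; apply: cvgD; [exact: cf|exact: cg].
- move=> a f; rewrite !inE => -[lf cf]; split.
    by move=> b u v; rewrite /= !fctE lf scalerDr !scalerA mulrC.
  by move=> x; apply: cvgZ; [exact: cvg_cst|exact: cf].
Qed.

HB.instance Definition _ := GRing.isSubmodClosed.Build R (E -> R^o)
  (@continuous_linear R E) continuous_linear_submod.
HB.instance Definition _ := [SubChoice_isSubLmodule of dual E by <:].

(* [initial_topology (a |-> a v)] is the coarsest topology making the
   evaluation at [v] continuous; the weak-* topology is their supremum. *)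
HB.instance Definition _ := Topological.copy (dual E)
  (sup_topology (fun v : E =>
    Topological.class (initial_topology (fun a : dual E => a v)))).

End dual_structures.

Section support.
Context (R : realType) (E : tvsType R).
Implicit Types C : set (dual E).

Definition support_functional C (v : E) : \bar R :=
  ereal_sup [set (a v)%:E | a in C].

Definition bounded_below_set C : set E :=
  [set v | -oo < ereal_inf [set (a v)%:E | a in C]]%E.

Definition semi_equicontinuous C :=
  exists U : set E, [/\ open U, U !=set0 &
    exists M : R, forall v, U v -> (`|support_functional C v| <= M%:E)%E].

End support.

Section partial_functions.
Context (R : realType) (E : tvsType R).

Definition partial_function := {Omega : set E & Omega -> R}.

Definition dom (F : partial_function) : set E := projT1 F.

Definition pfun (F : partial_function) : dom F -> R := projT2 F.

Definition convex_cone (Omega : set E) :=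
  convex_set Omega /\ forall (t : R) x, 0 < t -> Omega x -> Omega (t *: x).

(* The values of [F] are read off the total extension ['valL_0], which agrees
   with [F] on [dom F]; only points of [dom F] are tested as soon as [dom F]
   is a convex cone. *)
Definition pos_homogeneous (F : partial_function) :=
  forall (t : R) x, 0 < t -> dom F x ->
    'valL_0 (@pfun F) (t *: x) = t * 'valL_0 (@pfun F) x.

Definition pconvex (F : partial_function) :=
  convex_function (dom F) ('valL_0 (@pfun F)).

(* For non-empty [C] the support functional is finite on the domain below, so
   that [fine] only changes its type. *)
Definition support_restr (C : set (dual E)) : partial_function :=
  existT _ ((bounded_below_set (-%R @` C))°)
    (fun v => fine (support_functional C (\val v))).

End partial_functions.

(* Main.v *)
From HB Require Import structures.
Require Import Defs.
From mathcomp Require Import all_boot all_order all_algebra.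
From mathcomp Require Import all_classical all_reals all_analysis.
From mathcomp Require Import ring lra.
Import Order.TTheory GRing.Theory Num.Theory.
Import numFieldNormedType.Exports.
Local Open Scope classical_set_scope.
Local Open Scope ring_scope.

(** A weak-* closed convex set C is recovered from its support function s_C by
    separation, and a sublinear function f on an open convex cone Omega is
    recovered from the set of its continuous linear minorants by Hahn-Banach;
    both facts are drawn from one statement about cones.

    The common tool is [linear_functional_below_wedge].  Let G be a convex cone
    of pairs (u, a) in W x R such that (0, a) in G forces a >= 0 and such that G
    projects onto W.  Reading each pair as a constraint l u <= a, the system has
    a linear solution l: enlarge G to a maximal such cone by Zorn's lemma;
    maximality makes the lower envelope of G odd, and a sublinear odd function
    is linear.  Every separation below amounts to choosing the right constraints.

    The restriction of s_C is a legitimate value.  If s_C is bounded on an open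
    set U, a neighbourhood of any interior point x of B(-C) can be written
    y + t U with y in B(-C) and t > 0, so that s_C is bounded above near x
    ([support_continuous]); a convex function that is bounded above near a
    point is continuous there ([convex_bounded_continuous]).

    The assignment is injective because C is the set of all functionals lying
    below s_C on the interior of B(-C) ([closed_convex_supportP]).  For
    a functional a outside C there are finitely many vectors and an e > 0 such
    that every member of C differs from a by at least e on one of them, hence a
    is separated from C by a vector v in B(-C) ([weak_star_separation]).  Moving
    v slightly towards an interior point keeps the strict inequality and lands
    in the interior.

    The assignment is surjective because a continuous sublinear f on Omega is
    the support function of its minorants: at every x some minorant touches f
    ([sublinear_support]).  That B(-C) has no interior points outside Omega
    holds because, for v outside Omega and x in Omega, there is a functional b
    that is nonnegative on Omega, positive at x and nonpositive at v
    ([open_cone_separation]); subtracting multiples of b preserves minorants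
    and makes them unbounded from above at v - t x for every t > 0. *)

(** * Linear functionals below a cone of constraints *)

Section ConeFunctional.
Context {R : realType} {W : lmodType R}.
Implicit Types (G : set (W * R)) (u v : W) (a b t : R).

(** A pair (u, a) stands for the constraint l u <= a on an unknown linear l, so
    the first two clauses say that G contains the consequences of its members
    and the third that it does not contain a contradiction l 0 <= a with a < 0. *)
Definition wedge G :=
  [/\ forall u v a b, G (u, a) -> G (v, b) -> G (u + v, a + b),
      forall t u a, 0 < t -> G (u, a) -> G (t *: u, t * a) &
      forall a, G (0, a) -> 0 <= a].

Lemma wedgeU0 G : wedge G -> wedge (G `|` [set (0, 0)]).
Proof.
move=> [Gadd Gscale Gpos]; split=> [u v a b|t u a t0|a].
- move=> [Gu|[-> ->]] [Gv|[-> ->]]; rewrite ?(addr0, add0r); [left|by left..|].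
    exact: Gadd.
  by right.
- move=> [Gu|[-> ->]]; first by left; exact: Gscale.
  by right; rewrite scaler0 mulr0.
- by move=> [/Gpos//|[->]].
Qed.

(** Zorn's lemma: the clauses of [wedge] involve at most two members at a time,
    so they pass to unions of chains. *)
Lemma maximal_wedge G0 : wedge G0 ->
  exists G, [/\ wedge G, G0 `<=` G & forall H, wedge H -> G `<=` H -> H `<=` G].
Proof.
move=> wG0.
(* The empty chain must be admissible, so G0 is adjoined rather than required
   as a subset. *)
have [|A [wA maxA]] := @Zorn_bigcup _ [set X | wedge (X `|` G0)].
  move=> F FP Ftot.
  have pick p q : (\bigcup_(X in F) X `|` G0) p ->
      (\bigcup_(X in F) X `|` G0) q -> exists X,
      [/\ wedge (X `|` G0), (X `|` G0) `<=` (\bigcup_(X in F) X `|` G0),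
          (X `|` G0) p & (X `|` G0) q].
    have sub X : F X -> (X `|` G0) `<=` (\bigcup_(X in F) X `|` G0).
      by move=> FX z [Xz|]; [left; exists X|right].
    move=> [[X FX Xp]|Gp] [[Y FY Yq]|Gq].
    - have [XY|YX] := Ftot _ _ FX FY.
      + by exists Y; split; [exact: FP|exact: sub|left; exact: XY|left].
      + by exists X; split; [exact: FP|exact: sub|left|left; exact: YX].
    - by exists X; split; [exact: FP|exact: sub|left|right].
    - by exists Y; split; [exact: FP|exact: sub|right|left].
    - by exists set0; rewrite set0U; split => // z Gz; right.
  split=> [u v a b up vq|t u a t0 up|a ap].
  - by have [X [[H _ _] s Xp Xq]] := pick _ _ up vq; apply/s/H.
  - by have [X [[_ H _] s Xp _]] := pick _ _ up up; apply/s/H.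
  - by have [X [[_ _ H] _ Xp _]] := pick _ _ ap ap; exact: H.
exists (A `|` G0); split => // H wH AH.
have H0 : H `|` G0 = H by apply/setUidl => z Gz; apply: AH; right.
have AsH : A `<=` H by move=> z Az; apply: AH; left.
apply: contrapT => nHA; apply: (maxA H); last by rewrite /= H0.
by split=> // HA; apply: nHA => z /HA Az; left.
Qed.

(** If adjoining (u, a) to a maximal wedge is inconsistent, some member of G
    together with a positive multiple of (u, a) is contradictory; rescaled, that
    member is a constraint on - u that is stronger than l (- u) <= - a. *)
Lemma maximal_wedge_dichotomy G u a : wedge G -> G (0, 0) ->
  (forall H, wedge H -> G `<=` H -> H `<=` G) ->
  G (u, a) \/ exists2 c, c < - a & G (- u, c).
Proof.
move=> [Gadd Gscale Gpos] G0 Gmax.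
have [|nex] := pselect (exists2 c, c < - a & G (- u, c)); [by right|left].
pose H := [set p : W * R | exists v b t,
  [/\ G (v, b), 0 <= t & p = (v + t *: u, b + t * a)] ].
apply: (Gmax H); last first.
- by exists 0, 0, 1; rewrite scale1r mul1r !add0r.
- by move=> [v b] Gvb; exists v, b, 0; rewrite scale0r mul0r !addr0.
split=> [_ _ _ _ [v [b [t [Gvb t0 [-> ->]]]]] [w [c [s [Gwc s0 [-> ->]]]]]||].
- exists (v + w), (b + c), (t + s); split; [exact: Gadd|exact: addr_ge0|].
  by rewrite scalerDl mulrDl addrACA [b + _ + _]addrACA.
- move=> s _ _ s0 [v [b [t [Gvb t0 [-> ->]]]]].
  exists (s *: v), (s * b), (s * t); split; first exact: Gscale.
    by rewrite mulr_ge0// ltW.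
  by rewrite scalerDr mulrDr scalerA mulrA.
- move=> c [v [b [t [Gvb]]]]; rewrite le_eqVlt => /orP[/eqP <-|t0] [].
    by rewrite scale0r mul0r !addr0 => v0 ->; apply: Gpos; rewrite v0.
  move=> /esym/eqP; rewrite addr_eq0 => /eqP vE ->.
  rewrite leNgt; apply/negP => bta; apply: nex; exists (t^-1 * b).
    by rewrite ltr_pdivrMl// mulrN; lra.
  have := Gscale t^-1 _ _ _ Gvb; rewrite vE scalerN scalerA mulVf ?gt_eqF//.
  by rewrite scale1r; apply; rewrite invr_gt0.
Qed.

(** Hahn-Banach theorem in terms of constraints.  The tightest bound l u that a
    maximal wedge imposes at u is finite, because the wedge also bounds - u, and
    it is sublinear; the dichotomy makes it odd, hence linear. *)
Theorem linear_functional_below_wedge G :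
  wedge G -> (forall u, exists a, G (u, a)) ->
  exists l : W -> R^o, linear l /\ forall u a, G (u, a) -> l u <= a.
Proof.
move=> /wedgeU0/maximal_wedge[A [wA GA Amax]] Gtot.
have A0 : A (0, 0) by apply: GA; right.
have Atot u : exists a, A (u, a).
  by have [a Ga] := Gtot u; exists a; apply: GA; left.
have Adich u a := maximal_wedge_dichotomy _ u a wA A0 Amax.
have [Aadd Ascale Apos] := wA.
pose S u := [set a | A (u, a)].
pose l u : R^o := inf (S u).
have S0 u : S u !=set0 by exact: Atot.
have Slb u : has_lbound (S u).
  have [b Ab] := Atot (- u); exists (- b) => a Aa.
  by have := Aadd _ _ _ _ Aa Ab; rewrite subrr => /Apos; lra.
have l_le u a : A (u, a) -> l u <= a by move=> Aa; apply: ge_inf.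
have le_l u b : (forall a, A (u, a) -> b <= a) -> b <= l u.
  by move=> h; apply: lb_le_inf => // a; exact: h.
have lD u v : l (u + v) <= l u + l v.
  rewrite -lerBlDr; apply/le_l => a Aa; rewrite lerBlDl -lerBlDr.
  by apply/le_l => b Ab; rewrite lerBlDl; apply/l_le/Aadd.
have lZ_le t u : 0 < t -> t * l u <= l (t *: u).
  move=> t0; apply/le_l => a Aa; rewrite -ler_pdivlMl//; apply/l_le.
  have := Ascale t^-1 _ _ _ Aa; rewrite scalerA mulVf ?gt_eqF// scale1r.
  by apply; rewrite invr_gt0.
have lN u : l (- u) = - l u.
  apply/eqP; rewrite eq_le; apply/andP; split.
    apply/ler_addgt0Pr => e e0.
    have [Aa|[c cl Ac]] := Adich u (l u - e).
      by have := l_le _ _ Aa; lra.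
    by have := l_le _ _ Ac; lra.
  apply/le_l => b Ab; rewrite lerNl; apply/le_l => a Aa.
  by have := Aadd _ _ _ _ Aa Ab; rewrite subrr => /Apos; lra.
have lDE u v : l (u + v) = l u + l v.
  apply/eqP; rewrite eq_le lD/=.
  by have := lD (u + v) (- v); rewrite addrK lN; lra.
have l0 : l 0 = 0 by have := lN 0; rewrite oppr0; lra.
have lZ t u : 0 < t -> l (t *: u) = t * l u.
  move=> t0; apply/eqP; rewrite eq_le lZ_le// andbT.
  have tV0 : 0 < t^-1 by rewrite invr_gt0.
  have := lZ_le t^-1 (t *: u) tV0.
  by rewrite scalerA mulVf ?gt_eqF// scale1r mulrC ler_pdivrMr// mulrC.
exists l; split=> [t u v|u a Ga]; last by apply/l_le; apply: GA; left.
rewrite lDE; congr (_ + _); have [t0|t0|->] := ltgtP t 0.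
- by rewrite -[t]opprK scaleNr lN lZ ?oppr_gt0// scaleNr.
- exact: lZ.
- by rewrite !scale0r.
Qed.
End ConeFunctional.

(** * Convexity and continuity *)

Section Convexity.
Context {R : realType}.

Lemma convex_setP (M : lmodType R) (A : set M) : convex_set A <->
  forall x y (t : R), 0 <= t -> t <= 1 -> A x -> A y -> A (t *: x + (1 - t) *: y).
Proof.
split=> [cA x y t t0 t1 /mem_set Ax /mem_set Ay|cA x y t /set_mem Ax /set_mem Ay].
  exact: set_mem (cA x y (Itv01 t0 t1) Ax Ay).
by apply/mem_set/cA.
Qed.

Lemma convex_functionP (M : lmodType R) (D : set M) (f : M -> R) :
  convex_function D f <-> forall x y (t : R), 0 <= t -> t <= 1 -> D x -> D y ->
    f (t *: x + (1 - t) *: y) <= t * f x + (1 - t) * f y.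
Proof.
split=> [cf x y t t0 t1 /mem_set Dx /mem_set Dy|cf t x y /set_mem Dx /set_mem Dy].
  exact: (cf (Itv01 t0 t1) x y Dx Dy).
exact: cf.
Qed.

Lemma convex_coneP (E : tvsType R) (D : set E) : convex_cone D <->
  (forall x y, D x -> D y -> D (x + y)) /\
  (forall (t : R) x, 0 < t -> D x -> D (t *: x)).
Proof.
split=> [[/convex_setP cD DZ]|[DD DZ]]; split=> //.
  move=> x y Dx Dy; have h0 : 0 <= 2^-1 :> R by rewrite invr_ge0.
  have h1 : 2^-1 <= 1 :> R by rewrite invf_le1// ler1n.
  have := DZ 2 _ _ (cD x y _ h0 h1 Dx Dy).
  rewrite scalerDr !scalerA mulrBr mulr1 divff// scale1r.
  by rewrite (_ : 2 - 1 = 1) ?scale1r; [apply|lra].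
apply/convex_setP => x y t; rewrite le_eqVlt => /orP[/eqP <- _ _|t0].
  by rewrite scale0r subr0 scale1r add0r.
rewrite le_eqVlt => /orP[/eqP ->|t1] Dx Dy.
  by rewrite subrr scale0r scale1r addr0.
by apply: DD; apply: DZ => //; rewrite subr_gt0.
Qed.

End Convexity.

Section ConvexContinuity.
Context {R : realType} {E : tvsType R}.

Lemma nbhs_affine (D : set E) (x z : E) (c : R) :
  nbhs (z + c *: x) D -> nbhs x [set y | D (z + c *: y)].
Proof.
have scale_cts : {for x, continuous (fun y : E => c *: y)}.
  apply: (@continuous_comp E (R^o * E)%type E (fun y => (c, y))
    (fun p => p.1 *: p.2)); last exact: scale_continuous.
  by apply: (@cvg_pair _ _ _ _ (nbhs (c : R^o))); [exact: cvg_cst|exact: cvg_id].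
move=> nD.
suff add_cts : {for x, continuous (fun y : E => z + c *: y)} by exact: add_cts.
apply: (@continuous_comp E (E * E)%type E (fun y => (z, c *: y))
  (fun p => p.1 + p.2)); last exact: add_continuous.
by apply: cvg_pair => //; exact: cvg_cst.
Qed.

Lemma nbhs_homothety (D : set E) (x : E) (c : R) :
  nbhs x D -> nbhs x [set y | D (x + c *: (y - x))].
Proof.
move=> nD; rewrite (_ : [set y | _] = [set y | D (x - c *: x + c *: y)]).
  by apply: nbhs_affine; rewrite subrK.
by apply/seteqP; split=> y /=; rewrite scalerBr addrA addrAC.
Qed.

(** Write y = x + t k with t small.  Convexity on the segment from x to x + k
    bounds f y - f x by t (M - f x), and convexity on the segment from x - k to
    y, which contains x, gives the same bound for f x - f y. *)
Lemma convex_bounded_continuous (D : set E) (f : E -> R^o) (x : E) (M : R) :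
  nbhs x D -> convex_function D f -> (forall y, D y -> f y <= M) ->
  {for x, continuous f}.
Proof.
move=> nD /convex_functionP cf fM; apply/cvgrPdist_le => /= e e0.
have Dx : D x by exact: nbhs_singleton.
have fxM := fM _ Dx.
(* This t satisfies t (M - f x) <= e and t <= 1, without dividing by zero when
   f x = M. *)
pose t : R := e / (e + (M - f x)).
have eN0 : 0 < e + (M - f x) by lra.
have t0 : 0 < t by exact: divr_gt0.
have t1 : t <= 1 by rewrite ler_pdivrMr// mul1r; lra.
have tN : t * (M - f x) <= e by rewrite /t mulrAC ler_pdivrMr//; nra.
have nD1 : nbhs x [set y | D (x + t^-1 *: (y - x))] by exact: nbhs_homothety.
have nD2 : nbhs x [set y | D (x + (- t^-1) *: (y - x))] by exact: nbhs_homothety.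
near=> y.
have Dy : D y by near: y.
pose k := t^-1 *: (y - x).
have D1 : D (x + k) by rewrite /k; near: y.
have D2 : D (x - k) by rewrite /k -scaleNr; near: y.
have yE : y = x + t *: k by rewrite scalerA divff ?gt_eqF// scale1r addrC subrK.
have := cf _ _ _ (ltW t0) t1 D1 Dx.
rewrite scalerDr scalerBl scale1r addrC addrA subrK -yE => fy.
have t1_gt0 : 0 < 1 + t by lra.
have s0 : 0 <= (1 + t)^-1 by rewrite invr_ge0 ltW.
have s1 : (1 + t)^-1 <= 1 by rewrite invf_le1//; lra.
have := cf _ _ _ s0 s1 Dy D2.
have -> : 1 - (1 + t)^-1 = (1 + t)^-1 * t.
  by rewrite -{1}(@mulVf _ (1 + t)) ?gt_eqF// mulrDr mulr1 addrC addrA addNr add0r.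
rewrite -scalerA -scalerDr {1}yE scalerBr addrACA subrr addr0.
rewrite -{1}[x]scale1r -scalerDl scalerA mulVf ?gt_eqF// scale1r.
rewrite -mulrA -mulrDr ler_pdivlMl// => fx.
have := fM _ D1 => fD1; have := fM _ D2 => fD2.
rewrite ler_norml; apply/andP; split; nra.
Unshelve. all: by end_near.
Qed.

(** By linearity the upper bound near x translates to one near every point z. *)
Lemma linear_bounded_continuous (D : set E) (l : E -> R^o) (x : E) (M : R) :
  linear l -> nbhs x D -> (forall y, D y -> l y <= M) -> continuous l.
Proof.
move=> ll nD lM z.
have lB u v : l (u - v) = l u - l v by rewrite -scaleN1r addrC ll scaleN1r addrC.
have lD u v : l (u + v) = l u + l v by rewrite -[u]scale1r ll !scale1r.
have lZ c u : l (c *: u) = c * l u.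
  have l0 : l 0 = 0 by have := lB 0 0; rewrite subrr; lra.
  by rewrite -[c *: u]addr0 ll l0 addr0.
apply: (@convex_bounded_continuous [set y | D (x - z + 1 *: y)] _ _ (M - l (x - z))).
- by apply: nbhs_affine; rewrite scale1r subrK.
- by apply/convex_functionP => u v t _ _ _ _; rewrite lD !lZ.
- by move=> y /= /lM; rewrite lD scale1r; lra.
Qed.

End ConvexContinuity.

(** * Continuous linear functionals *)

Section DualSpace.
Context {R : realType} {E : tvsType R}.
Implicit Types (a b : dual E) (u v : E) (t : R).

Lemma dualDl a b v : (a + b) v = a v + b v. Proof. by []. Qed.
Lemma dualZl t a v : (t *: a) v = t * a v. Proof. by []. Qed.
Lemma dualNl a v : (- a) v = - a v. Proof. by []. Qed.

Lemma dual_linear a : linear a.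
Proof. by have /set_mem[] := dual_valP a. Qed.

Lemma dualD a u v : a (u + v) = a u + a v.
Proof. by have := dual_linear a 1 u v; rewrite !scale1r. Qed.

Lemma dual0 a : a 0 = 0.
Proof. by have := dualD a 0 0; rewrite addr0; lra. Qed.

Lemma dualZ a t v : a (t *: v) = t * a v.
Proof. by have := dual_linear a t v 0; rewrite !addr0 dual0 addr0. Qed.

Lemma dualN a v : a (- v) = - a v.
Proof. by rewrite -scaleN1r dualZ mulN1r. Qed.

Lemma dual_of_linear (D : set E) (l : E -> R^o) (x : E) (M : R) :
  linear l -> nbhs x D -> (forall y, D y -> l y <= M) ->
  exists a : dual E, forall v, a v = l v.
Proof.
move=> ll nD lM; have cl := linear_bounded_continuous _ _ _ _ ll nD lM.
by exists (Dual (mem_set (conj ll cl))).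
Qed.

Lemma nbhs_ray (D : set E) x u : nbhs x D -> exists2 t, 0 < t & D (x + t *: u).
Proof.
move=> nD; have scale_cts : {for (0 : R^o), continuous (fun t : R^o => t *: u)}.
  apply: (@continuous_comp R^o (R^o * E)%type E (fun t => (t, u))
    (fun p => p.1 *: p.2)); last exact: scale_continuous.
  by apply: (@cvg_pair _ _ _ _ (nbhs (0 : R^o)) (nbhs u)); [exact: cvg_id|exact: cvg_cst].
have add_cts : {for (0 : R^o), continuous (fun t : R^o => x + t *: u)}.
  apply: (@continuous_comp R^o (E * E)%type E (fun t => (x, t *: u))
    (fun p => p.1 + p.2)); last exact: add_continuous.
  by apply: cvg_pair => //; exact: cvg_cst.
have : nbhs (0 : R^o) [set t | D (x + t *: u)].
  by apply: add_cts; rewrite scale0r addr0.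
move=> /nbhs_ballP[e /= e0 eD]; exists (e / 2); first by rewrite divr_gt0.
apply: eD; rewrite /ball/= sub0r normrN gtr0_norm ?divr_gt0//.
by rewrite ltr_pdivrMr// ltr_pMr// ltr1n.
Qed.

End DualSpace.

(** * Support functions *)

Section SupportFunctional.
Context {R : realType} {E : tvsType R}.
Implicit Types (C : set (dual E)) (a : dual E) (u v x : E) (t : R).

Definition support_val C v : R := fine (support_functional C v).

(** This is B(-C); upper bounds on C spare the change of sign. *)
Definition bounded_on C : set E :=
  [set v | exists M : R, forall a, C a -> a v <= M].

Lemma bounded_below_setN C : bounded_below_set (-%R @` C) = bounded_on C.
Proof.
apply/seteqP; split=> [v|v [M CM]]; rewrite /bounded_below_set/=.
  move=> infC; have lb a : C a ->
      (ereal_inf [set (b v)%:E | b in -%R @` C] <= (- a v)%:E)%E.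
    by move=> Ca; apply: ereal_inf_lbound; exists (- a) => //; exists a.
  case: (ereal_inf _) infC lb => [m|_ lb|//] ; first move=> _ lb.
    by exists (- m) => a /lb; rewrite lee_fin lerNr.
  by exists 0 => a /lb; rewrite leye_eq.
apply: (@lt_le_trans _ _ (- M)%:E); first exact: ltNyr.
apply: le_ereal_inf_tmp => _ [_ [a Ca <-] <-].
by rewrite lee_fin dualNl lerN2; exact: CM.
Qed.

Lemma support_functionalE C v : C !=set0 -> bounded_on C v ->
  support_functional C v = (support_val C v)%:E.
Proof.
move=> [a Ca] [M CM]; rewrite /support_val fineK// fin_numE.
apply/andP; split; apply/eqP => sE.
  have : ((a v)%:E <= support_functional C v)%E.
    by apply: ereal_sup_ubound; exists a.
  by rewrite sE leeNy_eq.
have : (support_functional C v <= M%:E)%E.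
  by apply: ge_ereal_sup => _ [b Cb <-]; rewrite lee_fin; exact: CM.
by rewrite sE leye_eq.
Qed.

Lemma support_ge C a v : C a -> bounded_on C v -> a v <= support_val C v.
Proof.
move=> Ca Bv; rewrite -lee_fin -support_functionalE//; last by exists a.
by apply: ereal_sup_ubound; exists a.
Qed.

Lemma support_le C v M : C !=set0 -> (forall a, C a -> a v <= M) ->
  support_val C v <= M.
Proof.
move=> C0 CM; rewrite -lee_fin -support_functionalE//; last by exists M.
by apply: ge_ereal_sup => _ [a Ca <-]; rewrite lee_fin; exact: CM.
Qed.

Lemma bounded_onD C u v : bounded_on C u -> bounded_on C v ->
  bounded_on C (u + v).
Proof.
move=> [M CM] [N CN]; exists (M + N) => a Ca; rewrite dualD.
by apply: lerD; [exact: CM|exact: CN].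
Qed.

Lemma bounded_onZ C t v : 0 <= t -> bounded_on C v -> bounded_on C (t *: v).
Proof.
move=> t0 [M CM]; exists (t * M) => a Ca; rewrite dualZ.
by apply: ler_wpM2l => //; exact: CM.
Qed.

Lemma supportD C u v : C !=set0 -> bounded_on C u -> bounded_on C v ->
  support_val C (u + v) <= support_val C u + support_val C v.
Proof.
move=> C0 Bu Bv; apply: support_le => // a Ca; rewrite dualD.
by apply: lerD; exact: support_ge.
Qed.

Lemma supportZ_le C t v : C !=set0 -> 0 <= t -> bounded_on C v ->
  support_val C (t *: v) <= t * support_val C v.
Proof.
move=> C0 t0 Bv; apply: support_le => // a Ca; rewrite dualZ.
by apply: ler_wpM2l => //; exact: support_ge.
Qed.

Lemma supportZ C t v : C !=set0 -> 0 < t -> bounded_on C v ->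
  support_val C (t *: v) = t * support_val C v.
Proof.
move=> C0 t0 Bv; apply/eqP; rewrite eq_le supportZ_le ?(ltW t0)//=.
have Btv := bounded_onZ _ _ _ (ltW t0) Bv.
have tV0 : 0 <= t^-1 by rewrite invr_ge0 ltW.
have := supportZ_le C t^-1 _ C0 tV0 Btv.
by rewrite scalerA mulVf ?gt_eqF// scale1r ler_pdivlMl.
Qed.

Lemma support_convex C (D : set E) : C !=set0 -> D `<=` bounded_on C ->
  convex_function D (support_val C : E -> R^o).
Proof.
move=> C0 DB; apply/convex_functionP => x y t t0 t1 /DB Bx /DB By.
have s0 : 0 <= 1 - t by lra.
apply: le_trans (supportD C _ _ C0 (bounded_onZ C _ _ t0 Bx)
  (bounded_onZ C _ _ s0 By)) _.
by apply: lerD; exact: supportZ_le.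
Qed.

(** B(-C) is stable under translation by its members, so its interior is too. *)
Lemma interior_bounded_onD C x y : (bounded_on C)° x -> bounded_on C y ->
  (bounded_on C)° (x + y).
Proof.
move=> Bx By; have : nbhs (x + y) [set z | bounded_on C (- y + 1 *: z)].
  by apply: nbhs_affine; rewrite scale1r addrC addrK.
apply: filterS => z /= Bz.
by have := bounded_onD _ _ _ Bz By; rewrite scale1r addrAC addNr add0r.
Qed.

Lemma interior_bounded_onZ C t x : 0 < t -> (bounded_on C)° x ->
  (bounded_on C)° (t *: x).
Proof.
move=> t0 Bx; have : nbhs (t *: x) [set z | bounded_on C (0 + t^-1 *: z)].
  by apply: nbhs_affine; rewrite add0r scalerA mulVf ?gt_eqF// scale1r.
apply: filterS => z /= Bz; have := bounded_onZ _ _ _ (ltW t0) Bz.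
by rewrite add0r scalerA divff ?gt_eqF// scale1r.
Qed.

Lemma interior_bounded_on_cone C : convex_cone (bounded_on C)°.
Proof.
apply/convex_coneP; split=> [x y Bx /nbhs_singleton By|t x t0].
  exact: interior_bounded_onD.
exact: interior_bounded_onZ.
Qed.

Lemma semi_equicontinuous_interior C : semi_equicontinuous C ->
  (bounded_on C)° !=set0.
Proof.
move=> [U [oU [u Uu] [M UM]]]; exists u.
apply: (filterS _ (open_nbhs_nbhs (conj oU Uu))) => v Uv; exists M => a Ca.
have /UM := Uv; rewrite -lee_fin => sM; apply: le_trans (le_trans _ (lee_abs _)) sM.
by apply: ereal_sup_ubound; exists a.
Qed.

(** Let s_C <= M on the open set U and u in U.  For small t > 0 the vector
    y = x - t u still lies in B(-C), and y + t U is a neighbourhood of x on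
    which s_C <= s_C(y) + t M. *)
Lemma support_continuous C x : C !=set0 -> semi_equicontinuous C ->
  (bounded_on C)° x -> {for x, continuous (support_val C : E -> R^o)}.
Proof.
move=> C0 [U [oU [u Uu] [M UM]]] Bx.
have [t t0 [N xN]] := nbhs_ray _ x (- u) Bx.
pose D := [set z | U (- (t^-1 *: (x - t *: u)) + t^-1 *: z)].
have nD : nbhs x D.
  apply: nbhs_affine; rewrite scalerBr opprB scalerA mulVf ?gt_eqF// scale1r subrK.
  exact: open_nbhs_nbhs.
have DM z : D z -> forall a, C a -> a z <= N + t * M.
  move=> Dz a Ca; have /UM := Dz.
  move=> sM; have : ((a (- (t^-1 *: (x - t *: u)) + t^-1 *: z))%:E <= M%:E)%E.
    apply: le_trans (le_trans _ (lee_abs _)) sM.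
    by apply: ereal_sup_ubound; exists a.
  rewrite lee_fin dualD dualN !dualZ -mulrN -mulrDr ler_pdivrMl//.
  by have := xN a Ca; rewrite scalerN; lra.
apply: (@convex_bounded_continuous _ _ D _ x (N + t * M)) => //.
  by apply: support_convex => // z Dz; exists (N + t * M); exact: DM.
by move=> z Dz; apply: support_le => //; exact: DM.
Qed.

End SupportFunctional.

(** * Separation in the weak-* topology *)

(** The constraints are l w <= c whenever c bounds the coordinates of w, and
    l (- x) <= - e for x in K.  They are consistent: w = t x with x in K forces
    the sup norm of w to be at least t e. *)
Lemma rowspace_separation {R : realType} n (K : set 'rV[R]_n) (e : R) :
  K !=set0 -> convex_set K -> (forall x, K x -> exists i, e <= `|x 0 i|) ->
  exists c : 'I_n -> R, forall x, K x -> e <= \sum_i x 0 i * c i.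
Proof.
move=> [x0 Kx0] /convex_setP cK far.
pose G := [set p : 'rV[R]_n * R | exists (w : 'rV[R]_n) (c : R) x (t : R),
  [/\ K x, 0 <= t, (forall i, `|w 0 i| <= c) & p = (w - t *: x, c - t * e)] ].
have wG : wedge G.
  split.
  - move=> _ _ _ _ [w [c [x [t [Kx t0 wc [-> ->]]]]]]
      [w' [c' [x' [t' [Kx' t'0 wc' [-> ->]]]]]].
    have wwcc i : `|(w + w') 0 i| <= c + c'.
      by rewrite mxE; apply: le_trans (ler_normD _ _) (lerD _ _).
    (* t x + t' x' is t + t' times a convex combination, unless t = t' = 0. *)
    have [tt0|tt0] := eqVneq (t + t') 0.
      exists (w + w'), (c + c'), x, 0.
      have -> : t = 0 by lra.
      have -> : t' = 0 by lra.
      by split=> //; rewrite !scale0r !mul0r !subr0.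
    have tt_gt0 : 0 < t + t' by rewrite lt_neqAle eq_sym tt0 addr_ge0.
    pose r := t / (t + t').
    have rE : (t + t') * r = t by rewrite mulrC divfK.
    have rE' : (t + t') * (1 - r) = t' by rewrite mulrBr mulr1 rE; lra.
    exists (w + w'), (c + c'), (r *: x + (1 - r) *: x'), (t + t').
    split=> //.
    + apply: cK => //; first by rewrite divr_ge0// ltW.
      by rewrite ler_pdivrMr// mul1r lerDl.
    + exact: addr_ge0.
    + rewrite scalerDr !scalerA rE rE'.
      by congr (_, _); [rewrite addrACA opprD|ring].
  - move=> q _ _ q0 [w [c [x [t [Kx t0 wc [-> ->]]]]]].
    exists (q *: w), (q * c), x, (q * t); split=> //.
    + by rewrite mulr_ge0// ltW.
    + by move=> i; rewrite mxE normrM gtr0_norm// ler_wpM2l// ltW.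
    + by rewrite scalerBr mulrBr scalerA mulrA.
  - move=> _ [w [c [x [t [Kx t0 wc [/esym/eqP + ->]]]]]].
    rewrite subr_eq0 => /eqP wE; have [i ei] := far _ Kx.
    have := wc i; rewrite wE mxE normrM (ger0_norm t0) => tc.
    by rewrite subr_ge0; apply: le_trans tc; exact: ler_wpM2l.
have Gtot w : exists c, G (w, c).
  exists (\sum_i `|w 0 i|), w, (\sum_i `|w 0 i|), x0, 0; split=> //.
    by move=> i; rewrite (bigD1 i)//= lerDl sumr_ge0.
  by rewrite scale0r mul0r !subr0.
have [l [ll lG]] := linear_functional_below_wedge _ wG Gtot.
pose f : {linear 'rV[R]_n -> R^o} := HB.pack l (GRing.isLinear.Build _ _ _ _ _ ll).
exists (fun i => l (delta_mx 0 i)) => x Kx.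
suff -> : \sum_i x 0 i * l (delta_mx 0 i) = l x.
  have : l (- x) <= - e.
    apply: lG; exists 0, 0, x, 1; split=> //.
      by move=> i; rewrite mxE normr0.
    by rewrite scale1r mul1r !sub0r.
  by rewrite -[l]/(f : _ -> _) linearN lerN2.
rewrite -[l]/(f : _ -> _) {2}(row_sum_delta x) linear_sum.
by apply: eq_bigr => i _; rewrite linearZ.
Qed.

Section WeakStar.
Context {R : realType} {E : tvsType R}.
Implicit Types (C : set (dual E)) (a b : dual E) (v : E).

Lemma evaluation_continuous v : continuous (fun a : dual E => a v : R^o).
Proof.
move=> a; have /cvg_sup/(_ v) cvg_v : nbhs a --> a by exact: cvg_id.
apply: cvg_trans (@initial_continuous (dual E) R^o (fun b => b v) a).
by move=> A /= /cvg_v.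
Qed.

(** The sets cut out by finitely many evaluations generate a filter that
    converges to a for each initial topology, hence for their supremum. *)
Lemma weak_star_nbhs a (U : set (dual E)) : nbhs a U ->
  exists (s : seq E) (e : R), 0 < e /\
    forall b, (forall v, v \in s -> `|b v - a v| < e) -> U b.
Proof.
pose near_on (p : seq E * R) : set (dual E) :=
  [set b | forall v, v \in p.1 -> `|b v - a v| < p.2].
pose F := filter_from [set p : seq E * R | 0 < p.2] near_on.
have FF : Filter F.
  apply: filter_from_filter; first by exists ([::], 1) => /=.
  move=> [s e] [s' e'] /= e0 e0'; exists (s ++ s', Num.min e e').
    by rewrite /= lt_min e0.
  move=> b /= sb; split=> v vs.
    by have := sb v; rewrite mem_cat vs lt_min => /(_ isT)/andP[].
  by have := sb v; rewrite mem_cat vs orbT lt_min => /(_ isT)/andP[].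
have : F --> a.
  apply/cvg_sup => v A [_ [[W oW <-] /= Wa WA]].
  have /nbhs_ballP[e /= e0 eW] := open_nbhs_nbhs (conj oW Wa).
  exists ([:: v], e) => // b /= eb; apply: WA; apply: eW.
  by rewrite /ball/= distrC; apply: eb; rewrite inE.
move=> Fa /Fa [[s e] /= e0 sU]; exists s, e; split=> // b sb; exact: sU.
Qed.

(** Finitely many evaluations map C to a convex set of row vectors that stays
    away from the image of a; a linear functional on row vectors is a combination
    of coordinates, so it comes from evaluation at a vector of E. *)
Lemma weak_star_separation C a : C !=set0 -> closed C -> convex_set C ->
  ~ C a -> exists v (e : R), 0 < e /\ forall b, C b -> b v <= a v - e.
Proof.
move=> [c0 Cc0] clC /convex_setP cC nCa.
have : nbhs a (~` C) by apply: open_nbhs_nbhs; split=> //; exact: closed_openC.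
move=> /weak_star_nbhs[s [e [e0 sC]]].
pose k b : 'rV[R]_(size s) := \row_i (b s`_i - a s`_i).
have [|||c cP] := rowspace_separation _ (k @` C) e.
- by exists (k c0), c0.
- apply/convex_setP => _ _ t t0 t1 [b Cb <-] [b' Cb' <-].
  exists (t *: b + (1 - t) *: b'); first exact: cC.
  by apply/rowP => i; rewrite !mxE dualDl !dualZl; ring.
- move=> _ [b Cb <-]; apply: contrapT => /forallNP near_a.
  apply: (sC b) => // v vs; have vn : (index v s < size s)%N by rewrite index_mem.
  have := near_a (Ordinal vn); rewrite mxE/= nth_index// => /negP.
  by rewrite -ltNge.
pose v := \sum_i c i *: s`_i.
exists (- v), e; split=> // b Cb; rewrite !dualN.
have ev (d : dual E) : d v = \sum_(i < size s) c i * d s`_i.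
  rewrite /v; elim/big_ind2: _ => [|x u y w <- <-|i _]; first exact: dual0.
    by rewrite dualD.
  by rewrite dualZ.
have : e <= b v - a v.
  rewrite !ev -sumrB; apply: le_trans (cP _ (ex_intro2 _ _ b Cb erefl)) _.
  by rewrite le_eqVlt; apply/orP; left; apply/eqP/eq_bigr => i _; rewrite mxE; ring.
lra.
Qed.

End WeakStar.

(** * Sublinear functions on open convex cones *)

Section OpenCones.
Context {R : realType} {E : tvsType R} (D : set E).
Context (oD : open D) (cD : convex_cone D).
Implicit Types (u v x : E) (t s : R).

Let DD x y : D x -> D y -> D (x + y).
Proof. by move/convex_coneP: cD => [h _]; exact: h. Qed.

Let DZ t x : 0 < t -> D x -> D (t *: x).
Proof. by move/convex_coneP: cD => [_ h]; exact: h. Qed.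

Lemma open_cone_absorbs x u : D x -> exists2 s, 0 < s & D (u + s *: x).
Proof.
move=> Dx; have [t t0 Dt] := nbhs_ray D x u (open_nbhs_nbhs (conj oD Dx)).
exists t^-1; rewrite ?invr_gt0//.
rewrite addrC -[u]scale1r -(@mulVf _ t) ?gt_eqF// -scalerA -scalerDr.
by apply: DZ; rewrite ?invr_gt0.
Qed.

Lemma open_cone0 v : D 0 -> D v.
Proof. by move=> /(open_cone_absorbs 0 v)[s _]; rewrite scaler0 addr0. Qed.

(** The constraints are l x = 1, l v <= 0 and l (- y) <= 0 for y in D; a
    contradiction among them would express a nonnegative multiple of v as the
    sum of a point of D and a positive multiple of x, putting v or 0 in D, and
    0 in D forces D to be all of E.
    Continuity of l follows from the bound on - D, which is open. *)
Lemma open_cone_separation x v : D x -> ~ D v ->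
  exists a : dual E, [/\ forall y, D y -> 0 <= a y, 0 < a x & a v <= 0].
Proof.
move=> Dx nDv.
pose G := [set p : E * R | exists (y : E) (r s : R),
  [/\ D y, 0 <= s & p = (r *: x + s *: v - y, r)] ].
have wG : wedge G.
  split.
  - move=> _ _ _ _ [y [r [s [Dy s0 [-> ->]]]]] [z [q [t [Dz t0 [-> ->]]]]].
    exists (y + z), (r + q), (s + t); split; [exact: DD|exact: addr_ge0|].
    congr (_, _); rewrite !scalerDl opprD addrACA; congr (_ + _).
    by rewrite addrACA.
  - move=> t _ _ t0 [y [r [s [Dy s0 [-> ->]]]]].
    exists (t *: y), (t * r), (t * s); split; first exact: DZ.
      by rewrite mulr_ge0// ltW.
    by rewrite scalerBr scalerDr !scalerA.
  - move=> _ [y [r [s [Dy s0 [/esym/eqP + ->]]]]].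
    rewrite subr_eq0 leNgt => /eqP yE; apply/negP => r0; apply: nDv.
    have : D (s *: v).
      have -> : s *: v = y + (- r) *: x.
        by rewrite -yE scaleNr addrAC subrr add0r.
      by apply: DD => //; apply: DZ => //; rewrite oppr_gt0.
    move: s0; rewrite le_eqVlt => /orP[/eqP <-|s0].
      by rewrite scale0r; exact: open_cone0.
    move=> /(DZ s^-1); rewrite scalerA mulVf ?gt_eqF// scale1r; apply.
    by rewrite invr_gt0.
have Gtot u : exists r, G (u, r).
  have [r r0 Dr] := open_cone_absorbs _ (- u) Dx.
  exists r, (- u + r *: x), r, 0; split=> //.
  by rewrite scale0r addr0 opprD opprK addrCA subrr addr0.
have [l [ll lG]] := linear_functional_below_wedge _ wG Gtot.
have [a aE] : exists a : dual E, forall u, a u = l u.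
  apply: (@dual_of_linear _ _ [set u | D (0 + (- 1) *: u)] _ (- x) 0) => // [|y].
    apply: nbhs_affine; rewrite add0r scalerN scaleN1r opprK.
    exact: open_nbhs_nbhs.
  rewrite /= add0r scaleN1r => Dy; apply: lG; exists (- y), 0, 0; split=> //.
  by rewrite !scale0r opprK !add0r.
have aG y r s : D y -> 0 <= s -> r * a x + s * a v - a y <= r.
  by move=> Dy s0; rewrite -!dualZ -dualN -!dualD aE; apply: lG; exists y, r, s.
(* Only combinations that involve some y in D are constraints of G; y = x is
   enough to recover the sign at x, and s large the sign at v. *)
have ax : 0 < a x by have := aG x (- 1) 0 Dx (lexx _); lra.
exists a; split=> // [y Dy|]; first by have := aG y 0 0 Dy (lexx _); lra.
rewrite leNgt; apply/negP => av.
have s0 : 0 <= 2 * a x / a v by rewrite divr_ge0 ?mulr_ge0// ltW.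
by have := aG x 0 _ Dx s0; rewrite divfK ?gt_eqF//; lra.
Qed.

(** The constraints are l y <= f y for y in D and l (- x) <= - f x.  They
    are consistent since f (s x) = s f x.  Continuity of l
    follows from that of f at x. *)
Lemma sublinear_support (f : E -> R) x :
  (forall t y, 0 < t -> D y -> f (t *: y) = t * f y) ->
  (forall y z, D y -> D z -> f (y + z) <= f y + f z) ->
  {for x, continuous (f : E -> R^o)} -> D x ->
  exists a : dual E, (forall y, D y -> a y <= f y) /\ a x = f x.
Proof.
move=> fZ fD fx Dx.
pose G := [set p : E * R | exists (y : E) (s : R),
  [/\ D y, 0 <= s, p.1 = y - s *: x & f y - s * f x <= p.2] ].
have wG : wedge G.
  split.
  - move=> _ _ b c [y [s [Dy s0 /= -> yb]]] [z [t [Dz t0 /= -> zc]]].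
    exists (y + z), (s + t); split; [exact: DD|exact: addr_ge0| |].
      by rewrite /= scalerDl opprD addrACA.
    by have := fD _ _ Dy Dz; rewrite /=; lra.
  - move=> t _ c t0 [y [s [Dy s0 /= -> yc]]].
    exists (t *: y), (t * s); split; [exact: DZ|by rewrite mulr_ge0// ltW| |].
      by rewrite /= scalerBr scalerA.
    by rewrite /= fZ// -mulrA -mulrBr ler_wpM2l// ltW.
  - move=> c [y [s [Dy s0 /= /esym/eqP]]]; rewrite subr_eq0 => /eqP yE.
    apply: le_trans; move: s0; rewrite le_eqVlt => /orP[/eqP s0|s0].
      move: Dy; rewrite yE -s0 scale0r mul0r subr0 => D0.
      by have := fZ 2 0 (ltr0n _ 2) D0; rewrite scaler0; lra.
    by rewrite yE fZ// subrr.
have Gtot u : exists c, G (u, c).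
  have [s s0 Ds] := open_cone_absorbs _ u Dx.
  exists (f (u + s *: x) - s * f x), (u + s *: x), s.
  by rewrite /= addrK; split=> //; exact: ltW.
have [l [ll lG]] := linear_functional_below_wedge _ wG Gtot.
have lf y : D y -> l y <= f y.
  move=> Dy; apply: lG; exists y, 0; split=> //=; first by rewrite scale0r subr0.
  by rewrite mul0r subr0.
have near_x : nbhs x (D `&` [set y | f y <= f x + 1]).
  apply: filterI; first exact: open_nbhs_nbhs.
  have := fx; move=> /cvgrPdist_le/(_ 1 ltr01); apply: filterS => y.
  by rewrite ler_norml/=; lra.
have [|a aE] := dual_of_linear _ _ _ (f x + 1) ll near_x.
  by move=> y [/lf ly] /=; exact: le_trans.
exists a; split=> [y Dy|]; first by rewrite aE lf.
apply/eqP; rewrite eq_le aE lf//= -lerN2 -aE -dualN aE; apply: lG.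
exists x, 2; split=> //=; last by lra.
by rewrite -{2}[x]scale1r -scalerBl (_ : 1 - 2 = - 1) ?scaleN1r//; lra.
Qed.

End OpenCones.

(** * The correspondence *)

Section PartialFunctions.
Context {R : realType} {E : tvsType R}.
Implicit Types (F G : partial_function E) (C : set (dual E)).

Definition extension F : E -> R := 'valL_0 (@pfun R E F).

Lemma extensionE F (w : dom F) : extension F (\val w) = @pfun R E F w.
Proof. exact: (congr1 (@^~ w) (valLK 0 (@pfun R E F))). Qed.

Lemma extension_eq F G : dom F = dom G ->
  (forall v, dom F v -> extension F v = extension G v) -> F = G.
Proof.
case: F G => [D f] [D' g]; rewrite /dom/= => DD'; case: _ / DD' g => g fg.
congr existT; apply/funext => w.
have := fg (\val w) (set_mem (valP w)).
by rewrite (extensionE (existT _ D f)) (extensionE (existT _ D g)).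
Qed.

Lemma dom_support_restr C : dom (support_restr C) = (bounded_on C)°.
Proof. by rewrite /dom/= bounded_below_setN. Qed.

Lemma extension_support_restr C v : (bounded_on C)° v ->
  extension (support_restr C) v = support_val C v.
Proof.
rewrite -dom_support_restr => /mem_set Dv.
exact: (extensionE (support_restr C) (exist _ v Dv)).
Qed.

Lemma continuous_pfun F x : open (dom F) -> continuous (@pfun R E F) ->
  dom F x -> {for x, continuous (extension F : E -> R^o)}.
Proof.
move=> oF /(subspace_valL_continuousP' (dom F) (0 : R) (@pfun R E F)).2.
by rewrite continuous_open_subspace// => cF Fx; apply: cF; rewrite inE.
Qed.

Lemma support_restr_continuous C : C !=set0 -> semi_equicontinuous C ->
  continuous (@pfun R E (support_restr C)).
Proof.
move=> C0 sC w; have : (bounded_on C)° (\val w).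
  by rewrite -dom_support_restr; exact: set_mem (valP w).
move=> /(support_continuous _ _ C0 sC) sw.
apply: (@continuous_comp (set_type (dom (support_restr C))) E R^o set_val
  (support_val C)) => //.
exact: initial_continuous.
Qed.

Lemma support_restr_codomain C : C !=set0 -> semi_equicontinuous C ->
  let F := support_restr C in
  [/\ dom F !=set0, open (dom F), convex_cone (dom F),
      continuous (@pfun R E F) & pos_homogeneous F /\ pconvex F].
Proof.
move=> C0 sC F; rewrite {}/F; split; rewrite ?dom_support_restr.
- exact: semi_equicontinuous_interior.
- exact: open_interior.
- exact: interior_bounded_on_cone.
- exact: support_restr_continuous.
split.
- move=> t x t0; rewrite -/(extension (support_restr C)) dom_support_restr => Bx.
  rewrite !extension_support_restr//; last first.
    exact: interior_bounded_onZ.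
  by apply: supportZ => //; exact: nbhs_singleton.
- rewrite /pconvex -/(extension (support_restr C)) dom_support_restr.
  apply/convex_functionP => x y t t0 t1 Bx By.
  have /(_ _ _ C) [/convex_setP cB _] := interior_bounded_on_cone.
  rewrite !extension_support_restr//; last exact: cB.
  have /convex_functionP := support_convex C (bounded_on C)° C0 (@interior_subset _ _).
  exact.
Qed.

(** If a is not in C, separation gives v in B(-C) with a v > s_C(v), and the
    perturbation t x + v of v by an interior point x lies in the interior of
    B(-C) and still satisfies the strict inequality for small t > 0. *)
Lemma closed_convex_supportP C a : C !=set0 -> semi_equicontinuous C ->
  closed C -> convex_set C ->
  C a <-> forall v, (bounded_on C)° v -> a v <= support_val C v.
Proof.
move=> C0 sC clC cC; split=> [Ca v Bv|aC].
  by apply: support_ge => //; exact: nbhs_singleton.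
apply: contrapT => nCa.
have [v [e [e0 ve]]] := weak_star_separation _ _ C0 clC cC nCa.
have Bv : bounded_on C v by exists (a v - e).
have [x Bx] := semi_equicontinuous_interior _ sC.
(* Small enough for t (s_C(x) - a x) to absorb only half of the gap e. *)
pose t := e / (2 * (`|support_val C x - a x| + 1)).
have d0 : 0 < `|support_val C x - a x| + 1 by rewrite ltr_pwDr.
have t0 : 0 < t by rewrite divr_gt0// mulr_gt0.
have Btx := interior_bounded_onZ _ _ _ t0 Bx.
have := aC _ (interior_bounded_onD _ _ _ Btx Bv).
have := supportD _ _ _ C0 (nbhs_singleton Btx) Bv.
rewrite dualD dualZ supportZ//; last exact: nbhs_singleton.
have sv : support_val C v <= a v - e by exact: support_le.
have : t * (support_val C x - a x) <= e / 2.
  rewrite /t invfM mulrA mulrAC ler_pdivrMr// ler_wpM2l ?divr_ge0 ?ltW//.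
  by rewrite (le_lt_trans (ler_norm _))// ltrDl.
by lra.
Qed.

Definition minorants F : set (dual E) :=
  [set a | forall v, dom F v -> a v <= extension F v].

Lemma minorants_closed F : closed (minorants F).
Proof.
have -> : minorants F =
    \bigcap_(v in dom F) [set a : dual E | a v <= extension F v].
  by [].
apply: closed_bigI => v _.
apply: (@preimage_closed _ _ (fun a : dual E => a v : R^o)
  [set r : R^o | r <= extension F v]).
  by move=> a _; exact: evaluation_continuous.
exact: closed_le.
Qed.

Lemma minorants_convex F : convex_set (minorants F).
Proof.
apply/convex_setP => a b t t0 t1 aF bF v Fv.
rewrite dualDl !dualZl; have := aF _ Fv; have := bF _ Fv.
nra.
Qed.

Section Minorants.
Context (F : partial_function E).
Context (F0 : dom F !=set0) (oF : open (dom F)) (cF : convex_cone (dom F))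
  (F_cts : continuous (@pfun R E F)) (hF : pos_homogeneous F) (xF : pconvex F).

Let extensionD x y : dom F x -> dom F y ->
  extension F (x + y) <= extension F x + extension F y.
Proof.
move=> Fx Fy; have h0 : 0 <= 2^-1 :> R by rewrite invr_ge0.
have h1 : 2^-1 <= 1 :> R by rewrite invf_le1// ler1n.
have /convex_functionP/(_ x y _ h0 h1 Fx Fy) := xF.
have /convex_coneP[_ FZ] := cF.
have hpos : 0 < 2^-1 :> R by rewrite invr_gt0.
have -> : 1 - 2^-1 = 2^-1 :> R by lra.
rewrite -scalerDr -/(extension F) [extension F (_ *: _)]hF//; last first.
  by have /convex_coneP[FD _] := cF; exact: FD.
by rewrite -mulrDr ler_pM2l.
Qed.

Lemma minorant_exact x : dom F x ->
  exists a, minorants F a /\ a x = extension F x.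
Proof.
move=> Fx; apply: sublinear_support => //; exact: continuous_pfun.
Qed.

Let minorants0 : minorants F !=set0.
Proof. by have [x /minorant_exact[a [Fa _]]] := F0; exists a. Qed.

Lemma support_minorants x : dom F x -> support_val (minorants F) x = extension F x.
Proof.
move=> Fx; apply/eqP; rewrite eq_le support_le//=; last by move=> a; exact.
have [a [Fa <-]] := minorant_exact _ Fx.
by apply: support_ge => //; exists (extension F x) => b; exact.
Qed.

(** Take v in the interior of B(-C) but not in the domain, with x and b as in
    [open_cone_separation].  For a minorant a the functionals a - n b are
    minorants too, and their values at v - t x tend to infinity with n,
    although v - t x lies in B(-C) for small t > 0. *)
Lemma interior_bounded_on_minorants : (bounded_on (minorants F))° = dom F.
Proof.
have sub : dom F `<=` bounded_on (minorants F).
  by move=> v Fv; exists (extension F v) => a; exact.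
apply/seteqP; split=> [v Bv|v Fv]; last first.
  by apply: filterS sub _; exact: open_nbhs_nbhs.
apply: contrapT => nFv; have [x Fx] := F0.
have [b [b_ge0 bx bv]] := open_cone_separation _ oF cF _ _ Fx nFv.
have [t t0 [M BM]] := nbhs_ray _ _ (- x) Bv.
have [a aF] := minorants0.
have : 0 < t * b x by rewrite mulr_gt0.
set d := t * b x => d0.
(* Large enough for (a - n b) (v - t x) to exceed the alleged bound M. *)
pose n := (`|M - a (v - t *: x)| + 1) / d.
have n0 : 0 <= n by rewrite divr_ge0 ?ltW// addr_ge0.
have /BM : minorants F (a - n *: b).
  move=> w Fw; rewrite dualDl dualNl dualZl.
  have := mulr_ge0 n0 (b_ge0 _ Fw); have := aF _ Fw; lra.
rewrite scalerN dualDl dualNl dualZl.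
have : n * (b (v - t *: x)) <= - (`|M - a (v - t *: x)| + 1).
  rewrite dualD dualN dualZ -/d mulrBr {2}/n divfK ?gt_eqF//.
  have := mulr_ge0_le0 n0 bv; lra.
have := ler_norm (M - a (v - t *: x)); lra.
Qed.

Lemma minorants_semi_equicontinuous : semi_equicontinuous (minorants F).
Proof.
have [x Fx] := F0.
have near_x : nbhs x (dom F `&` [set y | `|extension F y| <= `|extension F x| + 1]).
  apply: filterI; first exact: open_nbhs_nbhs.
  have := continuous_pfun _ _ oF F_cts Fx; move=> /cvgrPdist_le/(_ 1 ltr01).
  apply: filterS => y /= xy.
  by rewrite -lerBlDl (le_trans (lerB_dist _ _))// distrC.
exists (dom F `&` [set y | `|extension F y| <= `|extension F x| + 1])°; split.
- exact: open_interior.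
- by exists x.
exists (`|extension F x| + 1) => v /nbhs_singleton[Fv vM].
rewrite support_functionalE//; last by exists (extension F v) => a; exact.
by rewrite support_minorants// abse_EFin lee_fin.
Qed.

Lemma support_restr_minorants : support_restr (minorants F) = F.
Proof.
apply: extension_eq; rewrite dom_support_restr interior_bounded_on_minorants//.
move=> v Fv; rewrite extension_support_restr ?support_minorants//.
by rewrite interior_bounded_on_minorants.
Qed.

End Minorants.
End PartialFunctions.

Theorem theorem2p4 (R : realType) (E : tvsType R) (hE : hausdorff_space E) :
  set_bij
    [set C : set (dual E) | [/\ C !=set0, semi_equicontinuous C, closed C &
       convex_set C]]
    [set F : partial_function E | [/\ dom F !=set0, open (dom F),
       convex_cone (dom F), continuous (@pfun R E F) &
       pos_homogeneous F /\ pconvex F]]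
    (@support_restr R E).
Proof.
split.
- by move=> C [C0 sC _ _]; exact: support_restr_codomain.
- move=> C C' /set_mem[C0 sC clC cC] /set_mem[C'0 sC' clC' cC'] CC'.
  have BB : (bounded_on C)° = (bounded_on C')° by rewrite -!dom_support_restr CC'.
  have ss v : (bounded_on C)° v -> support_val C v = support_val C' v.
    move=> Bv; rewrite -extension_support_restr// CC' extension_support_restr//.
    by rewrite -BB.
  apply/seteqP; split=> a.
  + move=> /closed_convex_supportP aC; apply/closed_convex_supportP => //.
    by rewrite -BB => v Bv; rewrite -ss//; exact: aC.
  + move=> /closed_convex_supportP aC; apply/closed_convex_supportP => //.
    by move=> v Bv; rewrite ss//; apply: aC => //; rewrite -BB.
- move=> F [F0 oF cF F_cts [hF xF]]; exists (minorants F).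
    split; [|exact: minorants_semi_equicontinuous|exact: minorants_closed|
      exact: minorants_convex].
    by have [x /minorant_exact[]// a [Fa _]] := F0; exists a.
  exact: support_restr_minorants.
Qed.
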